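(* Let $L$ and $E$ be finite lattices with greatest elements $1_L$, $1_E$, and let $\varphi\colon L\to E$ be a surjective residual mapping. (i) Let $m\in E$ be a meet-irreducible element of $E$. Then $\varphi^{-1}(m)\neq\emptyset$ and each $q\in L$ which is maximal in $\varphi^{-1}(m)$ is meet-irreducible in $L$. (ii) Let $m\in E$ and let each $q\in L$ with $\varphi(q)=m$ be meet-irreducible in $L$. Then $m$ is meet-irreducible in $E$. (iii) Assume $$(\dagger)\qquad \varphi(x)=1_E\implies x=1_L\quad\text{for all }x\in L.$$ Then for each coatom $m\in E$ there exists a coatom $q\in L$ such that $\varphi(q)=m$. (iv) Assume condition $(\dagger)$ and $$(\ddagger)\qquad \varphi(q)\le\varphi(q')\implies\varphi(q)=\varphi(q')\quad\text{for all coatoms }q,q'\in L.$$ Then $\varphi(q)$ is a coatom in $E$ if $q$ is a coatom in $L$. Moreover, the set of all coatoms of $E$ is $\{\varphi(q)\mid q\text{ a coatom in }L\}$.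
   Context: A mapping $\varphi\colon L\to E$ between finite lattices is called residual if it is a meet-homomorphism, i.e. $\varphi(x\wedge y)=\varphi(x)\wedge\varphi(y)$, and $\varphi(1_L)=1_E$. An element $m$ different from the greatest element is meet-irreducible if $m=a\wedge b$ implies $m=a$ or $m=b$. A coatom is an element covered by the greatest element. *)

(* Defs.v *)
From mathcomp Require Export all_boot all_order.

Set Implicit Arguments.
Unset Strict Implicit.
Unset Printing Implicit Defensive.

Export Order.TTheory.

Local Open Scope order_scope.

Definition residual (dL dE : Order.disp_t) (L : finTBLatticeType dL)
    (E : finTBLatticeType dE) (phi : L -> E) : Prop :=
  Order.meet_morphism phi /\ phi \top = \top.

Definition meet_irreducible (d : Order.disp_t) (L : finTBLatticeType d)
    (m : L) : Prop :=
  m <> \top /\ forall a b : L, m = a `&` b -> m = a \/ m = b.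

Definition covered_by (d : Order.disp_t) (L : finTBLatticeType d)
    (x y : L) : bool :=
  (x < y) && ~~ [exists z : L, x < z < y].

(* Boolean-valued so that the coatoms form a [{set L}]. *)
Definition coatom (d : Order.disp_t) (L : finTBLatticeType d) (q : L) : bool :=
  covered_by q \top.

Definition maximal_in (d : Order.disp_t) (L : finTBLatticeType d)
    (A : {set L}) (q : L) : Prop :=
  q \in A /\ forall x : L, x \in A -> q <= x -> x = q.

(* Main.v *)
Require Import Defs.

Set Implicit Arguments.
Unset Strict Implicit.
Unset Printing Implicit Defensive.

Local Open Scope order_scope.

(** Meet-irreducibility and coatoms both speak of how an element sits below
    others, and a surjective residual mapping lets such information travel in
    both directions: a meet decomposition of [q] is mapped to one of [phi q],
    and a decomposition of [m] lifts to the meet of preimages, which lies in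
    the fibre of [m].

    - If [q] is maximal in the fibre of a meet-irreducible [m] and
      [q = a `&` b], then [a] or [b] is mapped to [m]; it lies above [q], so it
      equals [q] by maximality.
    - If [m = a `&` b] and [x], [y] are preimages of [a], [b], then [x `&` y] is
      in the fibre of [m]; when it is irreducible, it equals [x] or [y].
    - Every element other than the top of a finite lattice lies below a coatom
      ([coatom_above]).  When only the top is mapped to the top, enlarging a
      preimage of a coatom [m] to a coatom [q] cannot push the image to the
      top, and [phi q >= m] then forces [phi q = m] ([coatom_lift]).
    - For a coatom [q], the element [phi q] lies below some coatom of [E], which
      lifts to a coatom [q'] of [L]; incomparability of the images of coatoms
      turns [phi q <= phi q'] into an equality. *)

Lemma coatom_neq_top (d : Order.disp_t) (L : finTBLatticeType d) (q : L) :
  coatom q -> q <> \top.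
Proof. by move=> /andP[lt_q _] q_top; rewrite q_top ltxx in lt_q. Qed.

Lemma coatom_max (d : Order.disp_t) (L : finTBLatticeType d) (q z : L) :
  coatom q -> q <= z -> z <> \top -> z = q.
Proof.
move=> /andP[_ /existsPn no_between] le_qz /eqP z_neq_top.
move: (no_between z); rewrite ltx1 z_neq_top andbT => not_lt_qz.
by move: le_qz; rewrite le_eqVlt (negPf not_lt_qz) orbF => /eqP.
Qed.

(** Climbing from [x] towards the top must stop, since the set of elements
    strictly above the current one shrinks at each step. *)
Lemma coatom_above (d : Order.disp_t) (L : finTBLatticeType d) (x : L) :
  x <> \top -> exists2 q : L, coatom q & x <= q.
Proof.
have [n] := ubnP #|[set z : L | x < z]|.
elim: n x => // n IHn x le_n /eqP x_neq_top.
have [x_coatom | ] := boolP (coatom x); first by exists x.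
rewrite /coatom /covered_by ltx1 x_neq_top /= negbK.
move=> /existsP[y /andP[lt_xy lt_y_top]].
have y_neq_top : y <> \top by apply/eqP; rewrite -ltx1.
have card_above_y : (#|[set z : L | (y < z)%O]| < n)%N.
  rewrite ltnS in le_n; apply: leq_trans le_n.
  apply/proper_card/properP; split; last by exists y; rewrite !inE ?ltxx.
  by apply/subsetP => z; rewrite !inE; apply: lt_trans.
have [q q_coatom le_yq] := IHn y card_above_y y_neq_top.
by exists q => //; apply: le_trans (ltW lt_xy) le_yq.
Qed.

Section Residual.

Variables (dL dE : Order.disp_t) (L : finTBLatticeType dL)
  (E : finTBLatticeType dE) (phi : L -> E).
Hypothesis phi_residual : residual phi.

Lemma residual_le (x y : L) : x <= y -> phi x <= phi y.
Proof.
case: phi_residual => phiI _ /meet_idPl xy.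
by apply/meet_idPl; rewrite -phiI xy.
Qed.

(** A factor of a meet decomposition of [q] lies above [q], so as soon as it
    falls in the fibre of [m], maximality identifies it with [q]. *)
Lemma maximal_in_fibre_irreducible (m : E) (q : L) :
  meet_irreducible m -> maximal_in (phi @^-1: [set m]) q ->
  meet_irreducible q.
Proof.
case: phi_residual => phiI phi1 [m_neq_top m_irr] [].
rewrite !inE => /eqP phi_q q_max.
split=> [q_top | a b q_eq]; first by apply: m_neq_top; rewrite -phi_q q_top.
have m_eq : m = phi a `&` phi b by rewrite -phiI -q_eq.
have [m_a | m_b] := m_irr _ _ m_eq; [left | right]; apply/esym/q_max.
- by rewrite !inE -m_a.
- by rewrite q_eq leIl.
- by rewrite !inE -m_b.
- by rewrite q_eq leIr.
Qed.

Hypothesis phi_surj : forall y : E, exists x : L, phi x = y.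

(** A decomposition of [m] lifts to a decomposition of one point of its fibre,
    namely the meet of arbitrary preimages of the two factors.  The fibre of the
    top contains the top, which is not irreducible, so [m] is not the top. *)
Lemma irreducible_fibre (m : E) :
  (forall q : L, phi q = m -> meet_irreducible q) -> meet_irreducible m.
Proof.
case: phi_residual => phiI phi1 fibre_irr; split=> [m_top | a b m_eq].
  by have [] := fibre_irr \top (etrans phi1 (esym m_top)).
have [x phi_x] := phi_surj a; have [y phi_y] := phi_surj b.
have phi_xy : phi (x `&` y) = m by rewrite phiI phi_x phi_y.
have [_ /(_ x y erefl)] := fibre_irr _ phi_xy.
by case=> xy_eq; [left | right]; rewrite -phi_xy xy_eq.
Qed.

Hypothesis phi_top : forall x : L, phi x = \top -> x = \top.

(** Any coatom above an arbitrary preimage of [m] will do: its image lies above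
    [m] without being the top, which leaves only [m]. *)
Lemma coatom_lift (m : E) : coatom m -> exists q : L, coatom q /\ phi q = m.
Proof.
case: phi_residual => _ phi1 m_coatom; have [x phi_x] := phi_surj m.
have x_neq_top : x <> \top.
  by move=> x_top; case: (coatom_neq_top m_coatom); rewrite -phi_x x_top.
have [q q_coatom le_xq] := coatom_above x_neq_top.
exists q; split=> //; apply: coatom_max => //.
  by rewrite -phi_x; apply: residual_le.
by move=> /phi_top; apply: coatom_neq_top.
Qed.

(** A coatom of [E] above [phi q] is itself the image of a coatom of [L], so the
    antichain condition on such images makes it equal to [phi q]. *)
Lemma coatom_image :
  (forall q q' : L, coatom q -> coatom q' ->
     phi q <= phi q' -> phi q = phi q') ->
  forall q : L, coatom q -> coatom (phi q).
Proof.
move=> phi_antichain q q_coatom.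
have phi_q_neq_top : phi q <> \top.
  by move=> /phi_top q_top; case: (coatom_neq_top q_coatom).
have [m m_coatom le_m] := coatom_above phi_q_neq_top.
have [q' [q'_coatom phi_q']] := coatom_lift m_coatom.
by rewrite (phi_antichain q q') ?phi_q'.
Qed.

End Residual.

Theorem proposition3p1 (dL dE : Order.disp_t) (L : finTBLatticeType dL)
    (E : finTBLatticeType dE) (phi : L -> E)
    (phi_residual : residual phi)
    (phi_surj : forall y : E, exists x : L, phi x = y) :
  (forall m : E, meet_irreducible m ->
     phi @^-1: [set m] <> set0 /\
     forall q : L, maximal_in (phi @^-1: [set m]) q -> meet_irreducible q) /\
  (forall m : E, (forall q : L, phi q = m -> meet_irreducible q) ->
     meet_irreducible m) /\
  ((forall x : L, phi x = \top -> x = \top) ->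
     forall m : E, coatom m -> exists q : L, coatom q /\ phi q = m) /\
  ((forall x : L, phi x = \top -> x = \top) ->
   (forall q q' : L, coatom q -> coatom q' ->
      phi q <= phi q' -> phi q = phi q') ->
     (forall q : L, coatom q -> coatom (phi q)) /\
     [set m : E | coatom m] = [set phi q | q : L & coatom q]).
Proof.
split; [|split; [|split]].
- move=> m m_irr; split; last by move=> q; apply: maximal_in_fibre_irreducible.
  have [x phi_x] := phi_surj m.
  by move=> /setP/(_ x); rewrite !inE phi_x eqxx.
- by move=> m; apply: irreducible_fibre.
- by move=> phi_top m; apply: coatom_lift.
- move=> phi_top phi_antichain.
  have image_coatom := coatom_image phi_residual phi_surj phi_top phi_antichain.
  split=> //; apply/setP => m; rewrite inE.
  apply/idP/imsetP => [m_coatom | [q + ->]].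
    have [q [q_coatom <-]] :=
      coatom_lift phi_residual phi_surj phi_top m_coatom.
    by exists q; rewrite ?inE.
  by rewrite inE; apply: image_coatom.
Qed.
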